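(* Let $\mathcal E$ be an elementary topos, with $\Box$ interpreted as the interior operator. Any internally preordered object $(X,r)$ in $\mathcal E$ validates the following two formulas, for every $\phi\colon X\to\Omega$: 1. $\forall x\,\Box\phi(x)\supset\Box\forall x\,\phi(x)$; 2. $\exists x\,\Box\phi(x)\supset\Box\exists x\,\phi(x)$.
   Context: Topos notation. $\top\colon 1\to\Omega$ is the subobject classifier. $PX$ is the power object of $X$ with membership morphism $\in_X\colon X\times PX\to\Omega$; each $f\colon X\times Y\to\Omega$ has a unique transpose $\hat f\colon Y\to PX$ with $\in_X\circ(1\times\hat f)=f$; $P1\cong\Omega$. For $f\colon A\to B$, the inverse image $Pf\colon PB\to PA$ is the transpose of $\in_B\circ(f\times 1)$. Each $PX$ is an internal Heyting algebra with order the equalizer of meet and first projection. Interior. A preordered object $(X,r)$ is an object with an internally reflexive and transitive relation $r\colon R\rightarrowtail X\times X$, with classifying morphism $\le_r$. $\uparrow\colon X\to PX$ is determined by $(a\in_X\uparrow b)=(b\le_r a)$, and $\downarrow\colon PX\to P^2X$ by $(u\in_{PX}\downarrow s)=(u\le s)$. Then $\mathsf{int}:=P(\uparrow)\circ\downarrow\colon PX\to PX$. On $\Omega\cong P1$, $\mathsf{int}\colon\Omega\to\Omega$ is the interior operator associated to the unique order $1\cong 1\times 1$ on the terminal object. Formulas. For $\phi\colon X\to\Omega$ with transpose $\hat\phi\colon 1\to PX$, $\Box\phi$ denotes $\mathsf{int}\circ\hat\phi\colon 1\to PX$ (equivalently the corresponding morphism $X\to\Omega$). $\forall_X,\exists_X\colon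 PX\to\Omega$ are the internal right and left adjoints of the inverse image $\Omega\cong P1\to PX$ along $X\to 1$; $\forall x\,\phi(x):=\forall_X\hat\phi$, $\exists x\,\phi(x):=\exists_X\hat\phi$, both morphisms $1\to\Omega$, and $\forall x\,\Box\phi(x):=\forall_X\circ\mathsf{int}\circ\hat\phi$, $\exists x\,\Box\phi(x):=\exists_X\circ\mathsf{int}\circ\hat\phi$. For a closed formula $\omega\colon 1\to\Omega$, $\Box\omega:=\mathsf{int}\circ\omega$ using $\mathsf{int}\colon\Omega\to\Omega$. The implication $\alpha\supset\beta$ of truth values $\alpha,\beta\colon 1\to\Omega$ is validated when $(\alpha\Rightarrow_\Omega\beta)=\top$, equivalently $\alpha\le\beta$ in the order on $\Omega$. *)

(* Defs.v *)
From Corelib Require Import ssreflect.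

Set Implicit Arguments.
Unset Strict Implicit.
Unset Printing Implicit Defensive.

Record category := Category {
  ob :> Type;
  hom : ob -> ob -> Type;
  idm : forall A, hom A A;
  comp : forall A B C, hom B C -> hom A B -> hom A C;
  comp_idl : forall A B (f : hom A B), comp (idm B) f = f;
  comp_idr : forall A B (f : hom A B), comp f (idm A) = f;
  compA : forall A B C D (h : hom C D) (g : hom B C) (f : hom A B),
    comp h (comp g f) = comp (comp h g) f
}.
Arguments idm {c} A.

Notation "g ∘ f" := (comp g f) (at level 40, left associativity).

Definition mono (C : category) (A B : C) (m : hom A B) : Prop :=
  forall (T : C) (f g : hom T A), m ∘ f = m ∘ g -> f = g.

(** The square with sides [p, f] and [q, g] commutes and is a pullback. *)
Definition is_pullback (C : category) (P A B D : C)
    (p : hom P A) (q : hom P B) (f : hom A D) (g : hom B D) : Prop :=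
  f ∘ p = g ∘ q /\
  forall (T : C) (a : hom T A) (b : hom T B), f ∘ a = g ∘ b ->
    exists! t : hom T P, p ∘ t = a /\ q ∘ t = b.

Record finlim := Finlim {
  fcat :> category;
  One : fcat;
  bang : forall A : fcat, hom A One;
  bang_uniq : forall (A : fcat) (f : hom A One), f = bang A;
  Prod : fcat -> fcat -> fcat;
  pr1 : forall A B, hom (Prod A B) A;
  pr2 : forall A B, hom (Prod A B) B;
  pair : forall T A B : fcat, hom T A -> hom T B -> hom T (Prod A B);
  pr1_pair : forall (T A B : fcat) (f : hom T A) (g : hom T B),
    pr1 A B ∘ pair f g = f;
  pr2_pair : forall (T A B : fcat) (f : hom T A) (g : hom T B),
    pr2 A B ∘ pair f g = g;
  pair_eta : forall (T A B : fcat) (h : hom T (Prod A B)),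
    pair (pr1 A B ∘ h) (pr2 A B ∘ h) = h;
  Eqz : forall A B : fcat, hom A B -> hom A B -> fcat;
  eqm : forall (A B : fcat) (f g : hom A B), hom (Eqz f g) A;
  eqm_eq : forall (A B : fcat) (f g : hom A B), f ∘ eqm f g = g ∘ eqm f g;
  eqm_univ : forall (A B : fcat) (f g : hom A B) (T : fcat) (h : hom T A),
    f ∘ h = g ∘ h -> exists! k : hom T (Eqz f g), eqm f g ∘ k = h
}.
Arguments One {_}.
Arguments bang {_} A.
Arguments pr1 {_ A B}.
Arguments pr2 {_ A B}.

Definition prodm (C : finlim) (A B A' B' : C) (f : hom A A') (g : hom B B') :
    hom (Prod A B) (Prod A' B') :=
  pair (f ∘ pr1) (g ∘ pr2).

Definition diag (C : finlim) (A : C) : hom A (Prod A A) :=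
  pair (idm A) (idm A).

Definition swap (C : finlim) (A B : C) : hom (Prod A B) (Prod B A) :=
  pair pr2 pr1.

Section Pullback.
Variables (C : finlim) (A B D : C) (f : hom A D) (g : hom B D).
Definition pb : C := Eqz (f ∘ (pr1 : hom (Prod A B) A)) (g ∘ pr2).
Definition pb1 : hom pb A := pr1 ∘ eqm (f ∘ pr1) (g ∘ pr2).
Definition pb2 : hom pb B := pr2 ∘ eqm (f ∘ pr1) (g ∘ pr2).
End Pullback.

Section FinlimFacts.
Variable C : finlim.
Implicit Types A B T : C.

Lemma bang_eq A (f g : hom A One) : f = g.
Proof. by rewrite (bang_uniq f) (bang_uniq g). Qed.

Lemma pair_comp T S A B (f : hom T A) (g : hom T B) (h : hom S T) :
  pair f g ∘ h = pair (f ∘ h) (g ∘ h).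
Proof. by rewrite -[LHS]pair_eta !compA pr1_pair pr2_pair. Qed.

Lemma pair_pr A B : pair pr1 pr2 = idm (Prod A B).
Proof. by rewrite -[RHS]pair_eta !comp_idr. Qed.

Lemma prodm_pair T A B A' B' (f : hom A A') (g : hom B B')
    (a : hom T A) (b : hom T B) :
  prodm f g ∘ pair a b = pair (f ∘ a) (g ∘ b).
Proof. by rewrite /prodm pair_comp -!compA pr1_pair pr2_pair. Qed.

Lemma swap_pair T A B (a : hom T A) (b : hom T B) :
  swap A B ∘ pair a b = pair b a.
Proof. by rewrite /swap pair_comp pr1_pair pr2_pair. Qed.

Lemma mono_from_One A (m : hom One A) : mono m.
Proof. move=> T f g _; exact: bang_eq. Qed.

Lemma eqm_mono A B (f g : hom A B) : mono (eqm f g).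
Proof.
move=> T h k e.
have fk : f ∘ (eqm f g ∘ k) = g ∘ (eqm f g ∘ k) by rewrite !compA eqm_eq.
case: (eqm_univ fk) => t [_ u].
by rewrite -(u h e) -(u k (eq_refl _)).
Qed.

End FinlimFacts.
Arguments mono_from_One {C A} m.
Arguments eqm_mono {C A B} f g.

Record topos := Topos {
  tcat :> finlim;
  Omega : tcat;
  true_ : hom One Omega;
  chi : forall (A B : tcat) (m : hom A B), mono m -> hom B Omega;
  chi_pullback : forall (A B : tcat) (m : hom A B) (hm : mono m),
    is_pullback m (bang A) (chi hm) true_;
  chi_uniq : forall (A B : tcat) (m : hom A B) (hm : mono m) (c : hom B Omega),
    is_pullback m (bang A) c true_ -> c = chi hm;
  Pow : tcat -> tcat;
  mem : forall X : tcat, hom (Prod X (Pow X)) Omega;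
  tr : forall X Y : tcat, hom (Prod X Y) Omega -> hom Y (Pow X);
  mem_tr : forall (X Y : tcat) (f : hom (Prod X Y) Omega),
    mem X ∘ prodm (idm X) (tr f) = f;
  tr_uniq : forall (X Y : tcat) (f : hom (Prod X Y) Omega) (h : hom Y (Pow X)),
    mem X ∘ prodm (idm X) h = f -> h = tr f
}.
Arguments Omega {_}.
Arguments true_ {_}.
Arguments Pow {_} X.
Arguments mem {_} X.

(** [f : A -> B] gives the inverse image [P f : P B -> P A]. *)
Definition invim (E : topos) (A B : E) (f : hom A B) : hom (Pow B) (Pow A) :=
  tr (mem B ∘ prodm f (idm (Pow B))).

(** The transpose [1 -> P X] of a predicate on [X]. *)
Definition name (E : topos) (X : E) (phi : hom X Omega) : hom One (Pow X) :=
  tr (phi ∘ (pr1 : hom (Prod X One) X)).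

Definition P1_to_Omega (E : topos) : hom (Pow One) (@Omega E) :=
  mem One ∘ pair (bang (Pow One)) (idm (Pow One)).
Definition Omega_to_P1 (E : topos) : hom (@Omega E) (Pow One) := tr pr2.
Arguments P1_to_Omega {E}.
Arguments Omega_to_P1 {E}.

Definition meetO (E : topos) : hom (Prod Omega Omega) (@Omega E) :=
  chi (mono_from_One (pair true_ true_)).
Arguments meetO {E}.

Definition leO (E : topos) : hom (Prod Omega Omega) (@Omega E) :=
  chi (eqm_mono meetO pr1).
Arguments leO {E}.

(** Heyting implication on [Omega] classifies the order, since
    [(a ⇒ b) = ⊤] iff [a ≤ b] for generalized elements. *)
Definition impO (E : topos) : hom (Prod Omega Omega) (@Omega E) := leO.
Arguments impO {E}.

(** Intersection: [x ∈ u ∧ v] is [(x ∈ u) ∧ (x ∈ v)]. *)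
Definition meetP (E : topos) (X : E) : hom (Prod (Pow X) (Pow X)) (Pow X) :=
  tr (meetO ∘ pair (mem X ∘ pair pr1 (pr1 ∘ pr2))
                   (mem X ∘ pair pr1 (pr2 ∘ pr2))).

Definition leP (E : topos) (X : E) : hom (Prod (Pow X) (Pow X)) Omega :=
  chi (eqm_mono (meetP X) pr1).

(** Internal adjunction [f ⊣ g] between internal posets with order predicates
    [leL] and [leM]: the equation [(f a ≤ b) = (a ≤ g b)]. *)
Definition internal_adjunction (E : topos) (L M : E)
    (leL : hom (Prod L L) Omega) (leM : hom (Prod M M) Omega)
    (f : hom L M) (g : hom M L) : Prop :=
  leM ∘ prodm f (idm M) = leL ∘ prodm (idm L) g.

(** Inverse image [Omega ≅ P 1 -> P X] along [X -> 1]. *)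
Definition const_pow (E : topos) (X : E) : hom Omega (Pow X) :=
  invim (bang X) ∘ Omega_to_P1.

Section Forcing.
Variable E : topos.
Implicit Types A B T S X : E.

(** Kripke-Joyal forcing at stage [T]. *)
Definition force T (p : hom T Omega) : Prop := p = true_ ∘ bang T.

Lemma force_comp T S (p : hom T Omega) (f : hom S T) : force p -> force (p ∘ f).
Proof. by rewrite /force => ->; rewrite -compA (bang_uniq (_ ∘ f)). Qed.

Lemma force_chi A B T (m : hom A B) (hm : mono m) (f : hom T B) :
  force (chi hm ∘ f) <-> exists k, m ∘ k = f.
Proof.
case: (chi_pullback hm) => c u; split.
- by move/u => [k [[e _] _]]; exists k.
- move=> [k <-]; rewrite /force compA c -compA.
  by congr (_ ∘ _); apply: bang_eq.
Qed.

Lemma force_ext T (p q : hom T Omega) :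
  (forall S (f : hom S T), force (p ∘ f) <-> force (q ∘ f)) -> p = q.
Proof.
move=> h.
pose m := eqm p (true_ ∘ bang T).
have key (c : hom T Omega) :
    (forall S (f : hom S T), force (c ∘ f) <-> force (p ∘ f)) ->
    is_pullback m (bang _) c true_.
  move=> hc; split.
    have : force (c ∘ m).
      apply/hc; rewrite /force /m eqm_eq -compA.
      by congr (_ ∘ _); apply: bang_eq.
    by [].
  move=> S a b e.
  have ea : p ∘ a = (true_ ∘ bang T) ∘ a.
    have /hc -> : force (c ∘ a) by rewrite /force e (bang_uniq b).
    by rewrite -compA; congr (_ ∘ _); apply: bang_eq.
  case: (eqm_univ ea) => k [ek uk]; exists k; split.
    by split=> //; apply: bang_eq.
  by move=> k' [ek' _]; apply: uk.
have mm : mono m by exact: eqm_mono.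
rewrite (chi_uniq mm (key p _)) //.
by rewrite -(chi_uniq mm (key q _)) // => S f; split=> /h.
Qed.

Lemma force_eqm A B T (f g : hom A B) (h : hom T A) :
  force (chi (eqm_mono f g) ∘ h) <-> f ∘ h = g ∘ h.
Proof.
split.
- by move/force_chi => [k <-]; rewrite !compA eqm_eq.
- by move/eqm_univ => [k [e _]]; apply/force_chi; exists k.
Qed.

Lemma force_meetO T (p q : hom T Omega) :
  force (meetO ∘ pair p q) <-> force p /\ force q.
Proof.
split.
- move/force_chi => [k]; rewrite pair_comp => e.
  have := f_equal (comp pr1) e; have := f_equal (comp pr2) e.
  by rewrite !pr1_pair !pr2_pair /force => <- <-; rewrite (bang_uniq k).
- move=> [-> ->]; apply/force_chi; exists (bang T).
  by rewrite pair_comp.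
Qed.

Lemma force_leO T (p q : hom T Omega) :
  force (leO ∘ pair p q) <->
  forall S (f : hom S T), force (p ∘ f) -> force (q ∘ f).
Proof.
split.
- move/force_eqm; rewrite pr1_pair => e S f.
  by rewrite -{1}e -compA pair_comp => /force_meetO [].
- move=> h; apply/force_eqm; rewrite pr1_pair.
  apply: force_ext => S f; rewrite -compA pair_comp.
  split; first by move/force_meetO => [].
  by move=> hp; apply/force_meetO; split=> //; apply: h.
Qed.

Lemma mem_pair_tr X A T (f : hom (Prod X A) Omega) (x : hom T X) (a : hom T A) :
  mem X ∘ pair x (tr f ∘ a) = f ∘ pair x a.
Proof. by rewrite -{2}(mem_tr f) -compA prodm_pair comp_idl. Qed.

Lemma pow_ext X T (u v : hom T (Pow X)) :
  (forall S (f : hom S T) (x : hom S X),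
     force (mem X ∘ pair x (u ∘ f)) <-> force (mem X ∘ pair x (v ∘ f))) ->
  u = v.
Proof.
move=> h.
suff euv : mem X ∘ prodm (idm X) u = mem X ∘ prodm (idm X) v.
  by rewrite (tr_uniq euv) -(tr_uniq (h := v) (eq_refl _)).
apply: force_ext => S f.
have e (w : hom T (Pow X)) :
    mem X ∘ prodm (idm X) w ∘ f = mem X ∘ pair (pr1 ∘ f) (w ∘ (pr2 ∘ f)).
  by rewrite /prodm -compA pair_comp comp_idl !compA.
by rewrite !e; apply: h.
Qed.

Lemma force_leP X T (u v : hom T (Pow X)) :
  force (leP X ∘ pair u v) <->
  forall S (f : hom S T) (x : hom S X),
    force (mem X ∘ pair x (u ∘ f)) -> force (mem X ∘ pair x (v ∘ f)).
Proof.
have e S (f : hom S T) (x : hom S X) :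
    mem X ∘ pair x (meetP X ∘ pair u v ∘ f) =
    meetO ∘ pair (mem X ∘ pair x (u ∘ f)) (mem X ∘ pair x (v ∘ f)).
  rewrite -compA mem_pair_tr -compA pair_comp -!compA !pair_comp -!compA.
  by rewrite !pr1_pair !pr2_pair !pr1_pair.
split.
- move/force_eqm; rewrite pr1_pair => h S f x.
  by rewrite -{1}h e => /force_meetO [].
- move=> h; apply/force_eqm; rewrite pr1_pair; apply: pow_ext => S f x.
  rewrite e; split; first by move/force_meetO => [].
  by move=> hu; apply/force_meetO; split=> //; apply: h.
Qed.

Lemma mem_invim A B T (f : hom A B) (a : hom T A) (u : hom T (Pow B)) :
  mem A ∘ pair a (invim f ∘ u) = mem B ∘ pair (f ∘ a) u.
Proof. by rewrite mem_pair_tr -compA prodm_pair comp_idl. Qed.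

Lemma mem_const_pow X T (x : hom T X) (w : hom T Omega) :
  mem X ∘ pair x (const_pow X ∘ w) = w.
Proof. by rewrite -compA mem_invim mem_pair_tr pr2_pair. Qed.

Lemma mem_name X T (phi : hom X Omega) (x : hom T X) (t : hom T One) :
  mem X ∘ pair x (name phi ∘ t) = phi ∘ x.
Proof. by rewrite mem_pair_tr -compA pr1_pair. Qed.

Lemma Omega_to_P1K : P1_to_Omega ∘ Omega_to_P1 = idm (@Omega E).
Proof.
rewrite -compA pair_comp comp_idl -(comp_idr Omega_to_P1) mem_pair_tr.
by rewrite pr2_pair.
Qed.

Lemma P1_to_OmegaK : Omega_to_P1 ∘ P1_to_Omega = idm (Pow (@One E)).
Proof.
apply: pow_ext => S f x; rewrite comp_idl -compA mem_pair_tr pr2_pair.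
by rewrite -compA pair_comp comp_idl (bang_uniq x) (bang_uniq (_ ∘ f)).
Qed.

End Forcing.

Section Quantifiers.
Variables (E : topos) (X : E).

Lemma internal_right_adjoint_uniq (f : hom (@Omega E) (Pow X))
    (g g' : hom (Pow X) Omega) :
  internal_adjunction leO (leP X) f g ->
  internal_adjunction leO (leP X) f g' -> g = g'.
Proof.
rewrite /internal_adjunction => -> e; apply: force_ext => S u.
have key (p : hom S Omega) : force (leO ∘ pair p (g ∘ u)) <->
    force (leO ∘ pair p (g' ∘ u)).
  have := f_equal (fun h => h ∘ pair p u) e.
  by rewrite -!compA !prodm_pair !comp_idl => ->.
split=> h.
- have /key/force_leO : force (leO ∘ pair (g ∘ u) (g ∘ u)) by apply/force_leO.
  by move/(_ _ (idm S)); rewrite !comp_idr; apply.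
- have /key/force_leO : force (leO ∘ pair (g' ∘ u) (g' ∘ u)) by apply/force_leO.
  by move/(_ _ (idm S)); rewrite !comp_idr; apply.
Qed.

Lemma internal_left_adjoint_uniq (f : hom (@Omega E) (Pow X))
    (g g' : hom (Pow X) Omega) :
  internal_adjunction (leP X) leO g f ->
  internal_adjunction (leP X) leO g' f -> g = g'.
Proof.
rewrite /internal_adjunction => <- e; apply: force_ext => S u.
have key (p : hom S Omega) : force (leO ∘ pair (g ∘ u) p) <->
    force (leO ∘ pair (g' ∘ u) p).
  have := f_equal (fun h => h ∘ pair u p) e.
  by rewrite -!compA !prodm_pair !comp_idl => ->.
split=> h.
- have /key/force_leO : force (leO ∘ pair (g' ∘ u) (g' ∘ u)) by apply/force_leO.
  by move/(_ _ (idm S)); rewrite !comp_idr; apply.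
- have /key/force_leO : force (leO ∘ pair (g ∘ u) (g ∘ u)) by apply/force_leO.
  by move/(_ _ (idm S)); rewrite !comp_idr; apply.
Qed.

(** [∀_X] is the characteristic map of the top element [1 -> P X]. *)
Lemma forall_pow_sig :
  {g : hom (Pow X) (@Omega E) | internal_adjunction leO (leP X) (const_pow X) g}.
Proof.
pose top : hom One (Pow X) := name (true_ ∘ bang X).
have topE T (t : hom T One) (x : hom T X) : force (mem X ∘ pair x (top ∘ t)).
  by rewrite mem_name; apply: force_comp.
exists (chi (mono_from_One top)).
apply: force_ext => S f; rewrite -(pair_eta f).
move: (pr1 ∘ f) (pr2 ∘ f) => w u.
rewrite -!compA !prodm_pair !comp_idl; split.
- move/force_leP => h; apply/force_leO => S' f' hw.
  rewrite -compA; apply/force_chi; exists (bang S').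
  apply: pow_ext => S'' f'' x; split=> _; last by rewrite -compA; apply: topE.
  rewrite -compA; apply: h; rewrite -compA mem_const_pow compA.
  exact: force_comp.
- move/force_leO => h; apply/force_leP => S' f' x.
  rewrite -compA mem_const_pow => /h; rewrite -compA.
  by move/force_chi => [k <-]; apply: topE.
Qed.

(** [∃_X u] is the infimum of all truth values [w] such that [u] is contained
    in the constant subobject with value [w]. *)
Lemma exists_pow_sig :
  {g : hom (Pow X) (@Omega E) | internal_adjunction (leP X) leO g (const_pow X)}.
Proof.
pose bounds : hom (Pow X) (Pow Omega) :=
  tr (leP X ∘ swap _ _ ∘ prodm (const_pow X) (idm (Pow X))).
pose inf : hom (Pow Omega) (@Omega E) :=
  leP Omega ∘ pair (idm _) (name (idm Omega) ∘ bang (Pow Omega)).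
exists (inf ∘ bounds).
have infE T (u : hom T (Pow X)) : force (inf ∘ bounds ∘ u) <->
    forall S (f : hom S T) (w : hom S Omega),
      force (leP X ∘ pair (u ∘ f) (const_pow X ∘ w)) -> force w.
{ have e S (f : hom S T) (w : hom S Omega) :
      mem Omega ∘ pair w (bounds ∘ u ∘ f) =
      leP X ∘ pair (u ∘ f) (const_pow X ∘ w).
    by rewrite -compA mem_pair_tr -compA prodm_pair comp_idl -compA swap_pair.
  rewrite -!compA pair_comp comp_idl -compA.
  split.
  - move/force_leP => h S f w; rewrite -e => /h.
    by rewrite -compA mem_name comp_idl.
  - move=> h; apply/force_leP => S f w.
    by rewrite e => /h; rewrite -compA mem_name comp_idl. }
apply: force_ext => S f; rewrite -(pair_eta f).
move: (pr1 ∘ f) (pr2 ∘ f) => u w.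
rewrite -[X in force X]compA -[X in _ <-> force X]compA !prodm_pair !comp_idl.
split.
- move/force_leO => h; apply/force_leP => S' f' x hx.
  rewrite -compA mem_const_pow; apply: h; rewrite -compA.
  apply/infE => S'' f'' v /force_leP /(_ _ (idm _) (x ∘ f'')).
  rewrite !comp_idr mem_const_pow; apply.
  by rewrite -pair_comp compA; apply: force_comp.
- move=> h; apply/force_leO => S' f'; rewrite -compA => /infE /(_ _ (idm _)).
  apply; rewrite comp_idr.
  by rewrite compA -pair_comp compA; apply: force_comp.
Qed.

(** The internal adjoints to [const_pow X]; unique by the lemmas above. *)
Definition forall_pow : hom (Pow X) (@Omega E) := proj1_sig forall_pow_sig.
Definition exists_pow : hom (Pow X) (@Omega E) := proj1_sig exists_pow_sig.

Lemma forall_pow_adj : internal_adjunction leO (leP X) (const_pow X) forall_pow.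
Proof. exact: (proj2_sig forall_pow_sig). Qed.

Lemma exists_pow_adj : internal_adjunction (leP X) leO exists_pow (const_pow X).
Proof. exact: (proj2_sig exists_pow_sig). Qed.

End Quantifiers.

Record preorder (E : topos) := Preorder {
  carrier :> E;
  rel : E;
  relm : hom rel (Prod carrier carrier);
  relm_mono : mono relm;
  relm_refl : exists d : hom carrier rel, relm ∘ d = diag carrier;
  relm_trans :
    exists t : hom (pb (pr2 ∘ relm) (pr1 ∘ relm)) rel,
      relm ∘ t = pair (pr1 ∘ relm ∘ pb1 (pr2 ∘ relm) (pr1 ∘ relm))
                      (pr2 ∘ relm ∘ pb2 (pr2 ∘ relm) (pr1 ∘ relm))
}.

Section Interior.
Variables (E : topos) (X : preorder E).

(** [le_rel] at [(a, b)] is [a ≤_r b]. *)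
Definition le_rel : hom (Prod X X) (@Omega E) := chi (@relm_mono E X).

(** [a ∈ up b] is [b ≤_r a]. *)
Definition up : hom X (Pow X) := tr (le_rel ∘ swap X X).

(** [u ∈ down s] is [u ≤ s]. *)
Definition down : hom (Pow X) (Pow (Pow X)) := tr (leP X).

Definition interior : hom (Pow X) (Pow X) := invim up ∘ down.

End Interior.

Section TerminalPreorder.
Variable E : topos.

Fact diag1_refl :
  exists d : hom (@One E) One, diag One ∘ d = diag One.
Proof. by exists (idm One); rewrite comp_idr. Qed.

Fact diag1_trans :
  exists t : hom (pb (pr2 ∘ diag One) (pr1 ∘ diag One)) (@One E),
    diag One ∘ t = pair (pr1 ∘ diag One ∘ pb1 (pr2 ∘ diag One) (pr1 ∘ diag One))
                        (pr2 ∘ diag One ∘ pb2 (pr2 ∘ diag One) (pr1 ∘ diag One)).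
Proof.
exists (bang _); rewrite /diag pair_comp.
by congr (pair _ _); apply: bang_eq.
Qed.

(** The terminal object with the order [1 ≅ 1 × 1]. *)
Definition terminal_preorder : preorder E :=
  Preorder (mono_from_One (diag One)) diag1_refl diag1_trans.

(** The interior operator of [terminal_preorder], read on [Omega ≅ P 1]. *)
Definition interiorO : hom (@Omega E) Omega :=
  P1_to_Omega ∘ interior terminal_preorder ∘ Omega_to_P1.

End TerminalPreorder.
Arguments interiorO {E}.

Definition box (E : topos) (X : preorder E) (phi : hom X Omega) :
    hom One (Pow X) :=
  interior X ∘ name phi.

Definition box_closed (E : topos) (w : hom One (@Omega E)) : hom One Omega :=
  interiorO ∘ w.

(** Quantification of a formula on [X] given by its transpose [1 -> P X]. *)
Definition all_ (E : topos) (X : E) (p : hom One (Pow X)) : hom One Omega :=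
  forall_pow X ∘ p.

Definition ex_ (E : topos) (X : E) (p : hom One (Pow X)) : hom One Omega :=
  exists_pow X ∘ p.

Definition implies (E : topos) (a b : hom One (@Omega E)) : hom One Omega :=
  impO ∘ pair a b.

Definition valid (E : topos) (a : hom One (@Omega E)) : Prop := a = true_.

(* Main.v *)
(** Interior is deflationary by reflexivity of the preorder.  On [Omega] it is
    inflationary: if [w] holds, its subobject of the terminal object is
    everything and so contains every up-set.  Both quantifiers, being adjoints,
    are monotone, so [Q (int u) ≤ Q u ≤ int (Q u)] for [Q] either quantifier. *)

From Corelib Require Import ssreflect.
Require Import Defs.

Set Implicit Arguments.
Unset Strict Implicit.
Unset Printing Implicit Defensive.

Section InternalOrder.
Variable E : topos.
Implicit Types T X : E.

Lemma leO_refl T (p : hom T Omega) : force (leO ∘ pair p p).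
Proof. by apply/force_leO. Qed.

Lemma leO_trans T (p q r : hom T Omega) :
  force (leO ∘ pair p q) -> force (leO ∘ pair q r) -> force (leO ∘ pair p r).
Proof. by move=> /force_leO pq /force_leO qr; apply/force_leO => S f /pq /qr. Qed.

Lemma leP_trans X T (u v w : hom T (Pow X)) :
  force (leP X ∘ pair u v) -> force (leP X ∘ pair v w) ->
  force (leP X ∘ pair u w).
Proof. by move=> /force_leP uv /force_leP vw; apply/force_leP => S f x /uv /vw. Qed.

Lemma adjunction_pair (L M : E) (leL : hom (Prod L L) Omega)
    (leM : hom (Prod M M) Omega) (f : hom L M) (g : hom M L) T
    (a : hom T L) (b : hom T M) :
  internal_adjunction leL leM f g ->
  leM ∘ pair (f ∘ a) b = leL ∘ pair a (g ∘ b).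
Proof.
move=> /(f_equal (fun h => h ∘ pair a b)).
by rewrite -!compA !prodm_pair !comp_idl.
Qed.

(** Across the adjunction the goal becomes an inequality in [Pow X] with right side [v]; it is the
    counit at [u] followed by [u ≤ v]. *)
Lemma forall_pow_mono X T (u v : hom T (Pow X)) :
  force (leP X ∘ pair u v) ->
  force (leO ∘ pair (forall_pow X ∘ u) (forall_pow X ∘ v)).
Proof.
have adj := adjunction_pair _ _ (forall_pow_adj X).
move=> uv; rewrite -adj; apply: leP_trans uv.
by rewrite adj; apply: leO_refl.
Qed.

(** Dually, [u ≤ v] is followed by the unit at [v]. *)
Lemma exists_pow_mono X T (u v : hom T (Pow X)) :
  force (leP X ∘ pair u v) ->
  force (leO ∘ pair (exists_pow X ∘ u) (exists_pow X ∘ v)).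
Proof.
have adj := adjunction_pair _ _ (exists_pow_adj X).
move=> uv; rewrite adj; apply: leP_trans uv _.
by rewrite -adj; apply: leO_refl.
Qed.

(** At stage [One] the map [bang One] is the identity, so forcing there is equality with [true_]. *)
Lemma valid_implies (a b : hom One (@Omega E)) :
  valid (implies a b) <-> force (leO ∘ pair a b).
Proof. by rewrite /valid /force (bang_eq (bang One) (idm One)) comp_idr. Qed.

End InternalOrder.

Section Interior.
Variable E : topos.

Lemma mem_interior (X : preorder E) (T : E) (x : hom T X) (u : hom T (Pow X)) :
  mem X ∘ pair x (interior X ∘ u) = leP X ∘ pair (up X ∘ x) u.
Proof. by rewrite -compA mem_invim mem_pair_tr. Qed.

Lemma mem_up_refl (X : preorder E) (T : E) (x : hom T X) :
  force (mem X ∘ pair x (up X ∘ x)).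
Proof.
rewrite mem_pair_tr -compA swap_pair; apply/force_chi.
case: (relm_refl X) => d ed; exists (d ∘ x).
by rewrite compA ed /diag pair_comp comp_idl.
Qed.

Lemma interior_le (X : preorder E) (T : E) (u : hom T (Pow X)) :
  force (leP X ∘ pair (interior X ∘ u) u).
Proof.
apply/force_leP => S f x.
(* The up-set of [x] lies in [u]; this inclusion is applied to the element [x] of its own up-set. *)
rewrite -compA mem_interior => /force_leP /(_ _ (idm S) x).
by rewrite !comp_idr; apply; apply: mem_up_refl.
Qed.

Lemma le_interiorO (T : E) (w : hom T Omega) :
  force (leO ∘ pair w (interiorO ∘ w)).
Proof.
apply/force_leO => S f hw.
rewrite -[_ ∘ f]compA.
set u := Omega_to_P1 ∘ (w ∘ f).
(* [P1_to_Omega] tests membership of the unique point, so the question becomes an inclusion of an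
   up-set in [u]. *)
have -> : interiorO ∘ (w ∘ f) =
    mem One ∘ pair (bang S) (interior (terminal_preorder E) ∘ u).
  rewrite /interiorO /P1_to_Omega -!compA pair_comp comp_idl.
  by congr (_ ∘ pair _ _); apply: bang_eq.
rewrite [X in force X](mem_interior (X := terminal_preorder E)).
apply/force_leP => S' f' x _.
rewrite /u -compA mem_pair_tr pr2_pair.
exact: force_comp.
Qed.

End Interior.

Theorem corollary4p9 (E : topos) (X : preorder E) (phi : hom (carrier X) Omega) :
  valid (implies (all_ (box phi)) (box_closed (all_ (name phi)))) /\
  valid (implies (ex_ (box phi)) (box_closed (ex_ (name phi)))).
Proof.
have int_le := interior_le (name phi).
(* The intermediate truth value is the quantifier applied to [name phi]. *)
split; apply/valid_implies; apply: leO_trans (le_interiorO _).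
- exact: forall_pow_mono.
- exact: exists_pow_mono.
Qed.
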